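(* Let $g$ be a scalar product on the linear space of mappings $\mathcal{H}:=\{T \mid T:\mathcal{D}\to\mathbb{R}^d\}$ such that $(\mathcal{H},g)$ is a Hilbert space. Let $J:\Omega\mapsto J(\Omega)\in\mathbb{R}$, where $\Omega=T(\Omega^0)$, be a shape functional and let $f:T\mapsto f(T):=J(T(\Omega^0))$ be the related objective function in terms of a deformation $T\in\mathcal{H}$. For invertible $T\in\mathcal{H}$ let $\nabla J(T)\in\mathcal{H}$ be defined by $$b(\nabla J(T),Z)_T=dJ(\Omega)[Z]\quad\text{for all }Z\in\mathcal{H},\qquad \Omega=T(\Omega^0),$$ and assume that all local bilinear forms $b(\cdot,\cdot)_T$ are related to the overall scalar product $g$ on the space of deformations in the following way for any invertible $T\in\mathcal{H}$: $$b(Z_1,Z_2)_T:=g(Z_1\circ T,\,Z_2\circ T)\qquad\text{for all }Z_1,Z_2\in\mathcal{H}.$$ Let the gradient $\nabla f(T)\in\mathcal{H}$ be defined by the scalar product $g$ via $g(\nabla f(T),Z)=f'(T)[Z]$ for all $Z\in\mathcal{H}$. Then for any invertible $T\in\mathcal{H}$ there holds $$\nabla f(T)=\nabla J(T)\circ T.$$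
   Context: $\mathcal{D}\subset\mathbb{R}^d$ is a fixed hold-all domain and $\Omega^0\subset\mathcal{D}$ is a fixed initial shape (a bounded Lipschitz domain). Shapes are the deformed sets $\Omega=T(\Omega^0)=\{T(x):x\in\Omega^0\}$ for mappings $T$ defined on $\mathcal{D}$. An invertible $T\in\mathcal{H}$ means a deformation representing a shape, i.e. a bijection $T:\mathcal{D}\to\mathcal{D}$; for such $T$ and $Z\in\mathcal{H}$ the compositions $Z\circ T$ and $Z\circ T^{-1}$ are elements of $\mathcal{H}$. The shape derivative of $J$ at $\Omega$ in direction $Z$ (perturbation of identity) is $$dJ(\Omega)[Z]:=\lim_{t\to0^+}\frac{J((I+tZ)(\Omega))-J(\Omega)}{t},$$ where $I$ is the identity map; $J$ is assumed shape differentiable, meaning that this limit exists for all $Z$ and that $Z\mapsto dJ(\Omega)[Z]$ is linear and continuous. $f'(T)[Z]$ denotes the directional derivative of $f$ at $T$ in direction $Z$, which is assumed to exist and to be linear and continuous in $Z$. For $\Omega=T(\Omega^0)$, since $J((I+tZ)(\Omega))=f((I+tZ)\circ T)=f(T+tZ\circ T)$, one has $dJ(\Omega)[Z]=f'(T)[Z\circ T]$. The bilinear form $b(\cdot,\cdot)_T$ on $\mathcal{H}$ may depend on $T$. *)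

(* Defs.v *)
From HB Require Import structures.
From mathcomp Require Import all_boot all_order all_algebra.
From mathcomp Require Import all_classical all_reals all_analysis.

Set Implicit Arguments.
Unset Strict Implicit.
Unset Printing Implicit Defensive.

Import Order.TTheory GRing.Theory Num.Theory.
Import numFieldNormedType.Exports.

Local Open Scope classical_set_scope.
Local Open Scope ring_scope.

Section Domains.
Context {R : realType} {d : nat}.
Implicit Types (A : set 'rV[R]_d) (x y n : 'rV[R]_d).

Definition domain A := [/\ A !=set0, open A & connected A].

Definition dotv x y : R := \sum_(i < d) x 0 i * y 0 i.

(* Near each boundary point A is the strict subgraph of a Lipschitz function in
   suitable orthonormal coordinates: n is the (unit) vertical direction, dotv x n
   the vertical coordinate of x, and x - dotv x n *: n its projection on the
   hyperplane orthogonal to n.  Only the values of h on that hyperplane matter;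
   a Lipschitz function on it extends to the whole space by composition with the
   projection.  The norm of 'rV[R]_d is the sup norm, which is equivalent to the
   Euclidean one. *)
Definition lipschitz_boundary A :=
  forall p, (closure A `\` A°) p ->
  exists (n : 'rV[R]_d) (h : 'rV[R]_d -> R^o) (k r : R),
    [/\ dotv n n = 1, k.-lipschitz h, 0 < r &
        forall x, ball p r x -> (A x <-> dotv x n < h (x - dotv x n *: n))].

Definition bounded_lipschitz_domain A :=
  [/\ domain A, bounded_set A & lipschitz_boundary A].

(* u(A) for a mapping u defined on D only. *)
Definition image_of (D : set 'rV[R]_d) (u : D -> 'rV[R]_d) A : set 'rV[R]_d :=
  u @` [set x : D | A (val x)].

End Domains.

(* The space of mappings D -> R^d is a complete normed space H together with an
   injective linear map ev sending an element of H to the mapping it is. *)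
Section Mappings.
Context {R : realType} {d : nat} {D : set 'rV[R]_d}.
Context {H : completeNormedModType R} (ev : {linear H -> (D -> 'rV[R]_d)}).
Implicit Types (T Z : H) (Omega : set 'rV[R]_d).

(* T as a map D -> D; the default value x is used only where T x leaves D, which
   does not happen when T is invertible. *)
Definition selfmap T (x : D) : D := insubd x (ev T x).

Definition invertible T := (forall x : D, D (ev T x)) /\ bijective (selfmap T).

Definition comp_stable := forall T Z, invertible T ->
  range ev (ev Z \o selfmap T) /\
  (forall S : D -> D, cancel (selfmap T) S -> cancel S (selfmap T) ->
     range ev (ev Z \o S)).

(* Z \o T as an element of H; under comp_stable it exists for invertible T, and
   it is unique when ev is injective. *)
Definition compH Z T : H := xget 0 [set W | ev W = ev Z \o selfmap T].

Definition perturb (t : R) Z (x : D) : 'rV[R]_d := val x + t *: ev Z x.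

Definition shape_quotient (J : set 'rV[R]_d -> R) Omega Z (t : R) : R^o :=
  (J (image_of (perturb t Z) Omega) - J Omega) / t.

Definition shape_derivative J Omega Z : R^o :=
  lim (shape_quotient J Omega Z t @[t --> 0^'+]).

Definition shape_differentiable J Omega :=
  [/\ forall Z, cvg (shape_quotient J Omega Z t @[t --> 0^'+]),
      linear (shape_derivative J Omega) &
      continuous (shape_derivative J Omega)].

Definition objective (J : set 'rV[R]_d -> R) Omega T : R^o :=
  J (image_of (ev T) Omega).

Definition directionally_differentiable (f : H -> R^o) T :=
  [/\ forall Z, derivable f T Z,
      linear (fun Z => 'D_Z f T) &
      continuous (fun Z => 'D_Z f T)].

End Mappings.

(* Main.v *)
Require Import Defs.
From HB Require Import structures.
From mathcomp Require Import all_boot all_order all_algebra.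
From mathcomp Require Import all_classical all_reals all_analysis.

Set Implicit Arguments.
Unset Strict Implicit.
Unset Printing Implicit Defensive.

Import Order.TTheory GRing.Theory Num.Theory.
Import numFieldNormedType.Exports.

Local Open Scope classical_set_scope.
Local Open Scope ring_scope.

(** The defining relations say that [g (gradf T)] represents [f'(T)] while
[g (gradJ T \o T)], tested against mappings of the form [Z \o T], represents
[dJ(Omega)].  Two facts turn this into equality of the representatives.

First, perturbing the shape by the identity is perturbing the deformation along
[Z \o T]: [(I + t Z) \o T = T + t (Z \o T)].  Hence the one-sided difference
quotients of [J] at [Omega = T(Omega0)] are those of [f] at [T], and since the
two-sided derivative of [f] exists, [dJ(Omega)[Z] = f'(T)[Z \o T]]
([shape_derivative_objective]).  So [gradf T] and [gradJ T \o T] have the same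
scalar product with every [Z \o T].

Second, because [T] is a bijection of [D] and composition with its inverse stays
in [H], every [W] in [H] is some [Z \o T] ([compH_surj]).  The two elements of
[H] therefore have the same scalar product with all of [H], and a scalar product
separates points ([dot_separates]). *)

Section ShapeCalculus.
Context {R : realType} {d : nat} {D : set 'rV[R]_d}.
Context {H : completeNormedModType R} (ev : {linear H -> (D -> 'rV[R]_d)}).
Implicit Types (T Z W : H) (Omega : set 'rV[R]_d).

Lemma val_selfmap T : invertible ev T -> forall x : D, val (selfmap ev T x) = ev T x.
Proof. by move=> [TD _] x; rewrite insubdK//; apply/mem_set/TD. Qed.

Lemma ev_compH T Z : comp_stable ev -> invertible ev T ->
  ev (compH ev Z T) = ev Z \o selfmap ev T.
Proof.
move=> Hc Ti; have [[W _ WE] _] := Hc T Z Ti.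
exact: (@xgetPex _ 0 [set W | ev W = ev Z \o selfmap ev T] (ex_intro _ W WE)).
Qed.

(** The preimage of [W] is [W \o T^-1]; this is where stability under composition
with inverses of deformations enters. *)
Lemma compH_surj T W : injective ev -> comp_stable ev -> invertible ev T ->
  exists Z, compH ev Z T = W.
Proof.
move=> ev_inj Hc Ti; have [_ [S TS ST]] := Ti.
have [_ /(_ S TS ST)[Z _ ZE]] := Hc T W Ti.
exists Z; apply: ev_inj; rewrite ev_compH// ZE.
by apply/funext => x /=; rewrite TS.
Qed.

Lemma image_of_perturb T Z Omega (t : R) : comp_stable ev -> invertible ev T ->
  image_of (perturb ev t Z) (image_of (ev T) Omega) =
  image_of (ev (t *: compH ev Z T + T)) Omega.
Proof.
move=> Hc Ti.
have evE (y : D) : ev (t *: compH ev Z T + T) y = perturb ev t Z (selfmap ev T y).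
  by rewrite linearP /= /perturb val_selfmap// ev_compH// addrC.
apply/seteqP; split => [_ [x [y yO yx] <-]|_ [y yO <-]].
  exists y => //; rewrite evE; congr (perturb _ _ _ _).
  by apply/val_inj; rewrite val_selfmap.
exists (selfmap ev T y); last by rewrite evE.
by exists y => //; rewrite val_selfmap.
Qed.

(** Chain rule between shapes and deformations.  The shape derivative is a limit
as [t] decreases to [0], the directional derivative a limit over nonzero [h];
differentiability of the objective makes the two agree. *)
Lemma shape_derivative_objective (J : set 'rV[R]_d -> R) T Z Omega :
  comp_stable ev -> invertible ev T ->
  derivable (objective ev J Omega) T (compH ev Z T) ->
  shape_derivative ev J (image_of (ev T) Omega) Z =
  'D_(compH ev Z T) (objective ev J Omega) T.
Proof.
move=> Hc Ti fT; rewrite /derive cvg_at_rightE//.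
rewrite /shape_derivative.
suff -> : shape_quotient ev J (image_of (ev T) Omega) Z =
    fun h : R => h^-1 *: ((objective ev J Omega \o shift T)
      (h *: compH ev Z T) - objective ev J Omega T) by [].
by apply/funext => t; rewrite /shape_quotient image_of_perturb// mulrC.
Qed.

End ShapeCalculus.

Lemma dot_separates (R : numDomainType) (U : lmodType R) (g : {dot U for idfun})
    (u v : U) :
  (forall w, g u w = g v w) -> u = v.
Proof.
move=> guv; apply/eqP; rewrite -subr_eq0; apply/negPn/negP => uv0.
have : 0 < g (u - v) (u - v) by exact: neq0_dnorm_gt0.
have -> : g (u - v) (u - v) = g u (u - v) - g v (u - v) by exact: linearBl.
by rewrite guv subrr ltxx.
Qed.

Theorem theorem3p1 (R : realType) (d : nat) (D Omega0 : set 'rV[R]_d)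
    (D_domain : domain D)
    (Omega0_lipschitz : bounded_lipschitz_domain Omega0)
    (Omega0_sub : Omega0 `<=` D)
    (H : completeNormedModType R) (ev : {linear H -> (D -> 'rV[R]_d)})
    (ev_inj : injective ev)
    (g : {dot H for idfun})
    (g_norm : forall Z : H, `|Z| = Num.sqrt (g Z Z))
    (H_comp : comp_stable ev)
    (J : set 'rV[R]_d -> R)
    (J_diff : forall T : H, invertible ev T ->
       shape_differentiable ev J (image_of (ev T) Omega0))
    (f_diff : forall T : H, invertible ev T ->
       directionally_differentiable (objective ev J Omega0) T)
    (b : H -> {biscalar H})
    (b_g : forall T : H, invertible ev T -> forall Z1 Z2 : H,
       b T Z1 Z2 = g (compH ev Z1 T) (compH ev Z2 T))
    (gradJ : H -> H)
    (gradJ_def : forall T : H, invertible ev T -> forall Z : H,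
       b T (gradJ T) Z = shape_derivative ev J (image_of (ev T) Omega0) Z)
    (gradf : H -> H)
    (gradf_def : forall T : H, invertible ev T -> forall Z : H,
       g (gradf T) Z = 'D_Z (objective ev J Omega0) T) :
  forall T : H, invertible ev T -> ev (gradf T) = ev (gradJ T) \o selfmap ev T.
Proof.
move=> T Ti; rewrite -ev_compH//; congr (ev _).
apply: (dot_separates (g := g)) => W.
have [Z <-] := compH_surj W ev_inj H_comp Ti.
rewrite gradf_def// -b_g// gradJ_def// shape_derivative_objective//.
by have [] := f_diff T Ti.
Qed.
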